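(* Let $A,B\in\mathbb R^{m\times n}$, $b\in\mathbb R^m$, and consider the generalized absolute value equation $Ax-B|x|=b$, $x\in\mathbb R^n$, with the associated data $P=A-B$, $Q=-A-B$, $c=b$. (a) Suppose that $m\le n$ and $$\inf_{D\in\mathcal D_{[-1,1]}}\sigma_{\min}(A-BD)>0.$$ Then, for every $\alpha>0$, every $\alpha$-projected stationary point belongs to $\mathcal S$. If, in addition, $\{y^k\}$ is generated from some $y^0\in\mathcal C$ by the safeguarded projected-gradient algorithm described in the context, there are constants $\underline\alpha,\overline\alpha$ with $0<\underline\alpha\le\alpha_k\le\overline\alpha<1/L$ for all $k$, and $\{y^k\}$ is bounded, then $\Phi(y^k)\to0$, $\operatorname{dist}(y^k,\mathcal S)\to0$, and every accumulation point of $\{y^k\}$ belongs to $\mathcal S$. (b) If, more specifically, $m=n$ and $\delta:=\sigma_{\min}(A)-\|B\|>0$, then the equation $Ax-B|x|=b$ has a unique solution $x^\dagger$, and every projected stationary point (that is, every $\alpha$-projected stationary point, for any $\alpha>0$) equals $y^\dagger:=((x^\dagger)^+,(x^\dagger)^-)$. Moreover, if $\{y^k\}$ is generated from some $y^0\in\mathcal C$ by the safeguarded projected-gradient algorithm and there are constants $\underline\alpha,\overline\alpha$ with $0<\underline\alpha\le\alpha_k\le\overline\alpha<1/L$ for all $k$, then $$y^k\to y^\dagger,\qquad \Phi(y^k)\to0.$$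
   Context: Norms are Euclidean (vectors) and spectral (matrices); inequalities, $|x|$, $x^+=\max\{x,0\}$ and $x^-=\max\{-x,0\}$ are componentwise and $\odot$ is the componentwise product. $\sigma_{\min}(W)$ for $W\in\mathbb R^{m\times n}$ is the smallest of its $\min\{m,n\}$ singular values. $\mathcal D_{[-1,1]}$ is the set of $n\times n$ diagonal matrices with diagonal entries in $[-1,1]$. For data $P,Q\in\mathbb R^{m\times n}$, $c\in\mathbb R^m$, let $\mathcal C:=\{(u,v)\in\mathbb R^n\times\mathbb R^n: u\ge0,\ v\ge0,\ u\odot v=0\}$. For $y=(u,v)\in\mathbb R^{2n}$ set $H:=[P,\ Q]$, $r(y):=Hy-c=Pu+Qv-c$, $\Phi(y):=\tfrac12\|Hy-c\|^2$, so $\nabla\Phi(y)=H^\top(Hy-c)$, and $L:=\|H\|^2$. Let $\mathcal S:=\{y\in\mathcal C: r(y)=0\}$. For a nonempty closed set $\Omega$, $\Pi_\Omega(y):=\operatorname{argmin}_{z\in\Omega}\|y-z\|$ (possibly set-valued), and $\operatorname{dist}(y,\Omega):=\inf_{z\in\Omega}\|y-z\|$. For $\alpha>0$, a point $y\in\mathcal C$ is $\alpha$-projected stationary if $y\in\Pi_{\mathcal C}(y-\alpha\nabla\Phi(y))$. Safeguarded projected-gradient algorithm. For $y=(u,v)\in\mathcal C$ let $\vartheta_i(y):=\operatorname{sgn}(u_i-v_i)\in\{-1,0,1\}$. Given $y^0\in\mathcal C$, an integer $q\ge1$, $\tau\ge0$, set $\nu_0=0$ and $s_c:=\max\{1,\|c\|\}$.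 At iteration $k=0,1,2,\dots$: choose a stepsize $\alpha_k>0$; choose $\bar y^{k+1}\in\Pi_{\mathcal C}(y^k-\alpha_k\nabla\Phi(y^k))$; set $\nu_{k+1}:=\nu_k+1$ if $\vartheta(\bar y^{k+1})=\vartheta(y^k)$ and $\nu_{k+1}:=0$ otherwise. The trigger $\mathcal T_k$ holds if and only if $\|H\bar y^{k+1}-c\|/s_c\le\tau$ or $\nu_{k+1}\ge q$. If $\mathcal T_k$ holds, a refinement candidate $\widehat y^{k+1}$ is computed by some rule (left open; the rule may fail to produce a candidate). If a candidate is produced and $\widehat y^{k+1}\in\mathcal C$ and $\Phi(\widehat y^{k+1})\le\Phi(\bar y^{k+1})$, set $y^{k+1}:=\widehat y^{k+1}$; in all other cases set $y^{k+1}:=\bar y^{k+1}$. *)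

(* Defs.v *)
(* MathComp / MathComp-Analysis *)
From mathcomp Require Import all_boot all_order all_algebra.
From mathcomp Require Import all_classical all_reals all_analysis.
Set Implicit Arguments.
Unset Strict Implicit.
Unset Printing Implicit Defensive.
Import Order.TTheory GRing.Theory Num.Theory.
Import numFieldNormedType.Exports.
Local Open Scope classical_set_scope.
Local Open Scope ring_scope.

(* The library's norm on matrices is the sup norm, and it has no Euclidean or
   spectral norm; only its topology (the usual one) is used here. *)

Definition enorm (R : realType) (n : nat) (x : 'cV[R]_n) : R :=
  Num.sqrt (\sum_i x i 0 ^+ 2).

(* Norm induced by the Euclidean norms. *)
Definition spectral_norm (R : realType) (m n : nat) (W : 'M[R]_(m, n)) : R :=
  sup [set enorm (W *m x) | x in [set x : 'cV[R]_n | enorm x <= 1]].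

(* The min(m, n) singular values (without multiplicities): square roots of the
   eigenvalues of the smaller of the two Gram matrices W W^T and W^T W. *)
Definition singular_values (R : realType) (m n : nat) (W : 'M[R]_(m, n)) :
    set R :=
  [set s | 0 <= s /\
    (if (m <= n)%N then eigenvalue (W *m W^T) (s ^+ 2)
     else eigenvalue (W^T *m W) (s ^+ 2))].

(* The set is finite, and nonempty if m, n > 0, so this is its least element.
   If m = 0 or n = 0 there is no singular value and the value is 0. *)
Definition sigma_min (R : realType) (m n : nat) (W : 'M[R]_(m, n)) : R :=
  inf (singular_values W).

Definition unit_diag (R : realType) (n : nat) : set 'M[R]_n :=
  [set D | is_diag_mx D /\ forall i, -1 <= D i i <= 1].

Definition absv (R : realType) (n : nat) (x : 'cV[R]_n) : 'cV[R]_n :=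
  \col_i `|x i 0|.

Definition pos_part (R : realType) (n : nat) (x : 'cV[R]_n) : 'cV[R]_n :=
  \col_i Num.max (x i 0) 0.

Definition neg_part (R : realType) (n : nat) (x : 'cV[R]_n) : 'cV[R]_n :=
  \col_i Num.max (- x i 0) 0.

Definition gave_solution (R : realType) (m n : nat) (A B : 'M[R]_(m, n))
    (b : 'cV[R]_m) (x : 'cV[R]_n) : Prop :=
  A *m x - B *m absv x = b.

(* A pair y = (u, v) is the stacked vector col_mx u v, so that u = usubmx y and
   v = dsubmx y. *)

Definition compl_set (R : realType) (n : nat) : set 'cV[R]_(n + n) :=
  [set y | forall i : 'I_n,
    [/\ 0 <= usubmx y i 0, 0 <= dsubmx y i 0
      & usubmx y i 0 * dsubmx y i 0 = 0]].

Definition Hmx (R : realType) (m n : nat) (P Q : 'M[R]_(m, n)) :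
    'M[R]_(m, n + n) := row_mx P Q.

Definition residual (R : realType) (m n : nat) (P Q : 'M[R]_(m, n))
    (c : 'cV[R]_m) (y : 'cV[R]_(n + n)) : 'cV[R]_m := Hmx P Q *m y - c.

Definition Phi (R : realType) (m n : nat) (P Q : 'M[R]_(m, n))
    (c : 'cV[R]_m) (y : 'cV[R]_(n + n)) : R :=
  2^-1 * enorm (residual P Q c y) ^+ 2.

Definition gradPhi (R : realType) (m n : nat) (P Q : 'M[R]_(m, n))
    (c : 'cV[R]_m) (y : 'cV[R]_(n + n)) : 'cV[R]_(n + n) :=
  (Hmx P Q)^T *m residual P Q c y.

Definition Lconst (R : realType) (m n : nat) (P Q : 'M[R]_(m, n)) : R :=
  spectral_norm (Hmx P Q) ^+ 2.

Definition sol_set (R : realType) (m n : nat) (P Q : 'M[R]_(m, n))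
    (c : 'cV[R]_m) : set 'cV[R]_(n + n) :=
  [set y | compl_set y /\ residual P Q c y = 0].

Definition proj (R : realType) (N : nat) (Omega : set 'cV[R]_N)
    (y : 'cV[R]_N) : set 'cV[R]_N :=
  [set z | Omega z /\ forall w, Omega w -> enorm (y - z) <= enorm (y - w)].

(* Extended-real infimum, so that the distance to an empty set is +oo and
   convergence of the distance to 0 has content whatever Omega is. *)
Definition edistance (R : realType) (N : nat) (y : 'cV[R]_N)
    (Omega : set 'cV[R]_N) : \bar R :=
  ereal_inf [set (enorm (y - z))%:E | z in Omega].

Definition proj_stationary (R : realType) (m n : nat) (P Q : 'M[R]_(m, n))
    (c : 'cV[R]_m) (alpha : R) (y : 'cV[R]_(n + n)) : Prop :=
  compl_set y /\ proj (@compl_set R n) (y - alpha *: gradPhi P Q c y) y.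

Definition theta (R : realType) (n : nat) (y : 'cV[R]_(n + n)) : 'cV[R]_n :=
  \col_i Num.sg (usubmx y i 0 - dsubmx y i 0).

Definition trigger (R : realType) (m n : nat) (P Q : 'M[R]_(m, n))
    (c : 'cV[R]_m) (q : nat) (tau : R) (ybar : 'cV[R]_(n + n)) (nu : nat) :
    Prop :=
  enorm (residual P Q c ybar) / Num.max 1 (enorm c) <= tau \/ (q <= nu)%N.

Definition accepted (R : realType) (m n : nat) (P Q : 'M[R]_(m, n))
    (c : 'cV[R]_m) (ybar yhat : 'cV[R]_(n + n)) : Prop :=
  compl_set yhat /\ Phi P Q c yhat <= Phi P Q c ybar.

(* The refinement rule is arbitrary: cand k.+1 is the candidate that it computes
   at iteration k, None if it produces none, and is ignored unless the trigger
   holds. The values ybar 0 and cand 0 play no role. *)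
Record safeguarded_pg (R : realType) (m n : nat) (P Q : 'M[R]_(m, n))
    (c : 'cV[R]_m) (q : nat) (tau : R) (alpha : nat -> R)
    (y ybar : nat -> 'cV[R]_(n + n)) (nu : nat -> nat)
    (cand : nat -> option 'cV[R]_(n + n)) : Prop := SafeguardedPG {
  spg_init : compl_set (y 0%N);
  spg_q : (1 <= q)%N;
  spg_tau : 0 <= tau;
  spg_nu0 : nu 0%N = 0%N;
  spg_alpha : forall k, 0 < alpha k;
  spg_ybar : forall k,
    proj (@compl_set R n) (y k - alpha k *: gradPhi P Q c (y k)) (ybar k.+1);
  spg_nu : forall k,
    nu k.+1 = if theta (ybar k.+1) == theta (y k) then (nu k).+1 else 0%N;
  spg_step : forall k,
    y k.+1 = if cand k.+1 is Some yhat then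
               if `[< trigger P Q c q tau (ybar k.+1) (nu k.+1) /\
                      accepted P Q c (ybar k.+1) yhat >]
               then yhat else ybar k.+1
             else ybar k.+1 }.

(* y is generated from some starting point in the complementarity set, for some
   q, tau and some outcome of the refinement rule. *)
Definition generated_by_spg (R : realType) (m n : nat) (P Q : 'M[R]_(m, n))
    (c : 'cV[R]_m) (alpha : nat -> R) (y : nat -> 'cV[R]_(n + n)) : Prop :=
  exists q tau ybar nu cand, safeguarded_pg P Q c q tau alpha y ybar nu cand.

Definition admissible_steps (R : realType) (L : R) (alpha : nat -> R) : Prop :=
  exists alo ahi : R,
    [/\ 0 < alo, ahi < 1 / L & forall k, alo <= alpha k <= ahi].

Definition bounded_seq (R : realType) (N : nat) (y : nat -> 'cV[R]_N) : Prop :=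
  exists M : R, forall k, enorm (y k) <= M.

(* Main.v *)
Require Import Defs.
From mathcomp Require Import all_boot all_order all_algebra.
From mathcomp Require Import all_classical all_reals all_analysis.
From mathcomp Require Import ring lra.
Import Order.TTheory GRing.Theory Num.Theory.
Import numFieldNormedType.Exports.
Set Implicit Arguments.
Unset Strict Implicit.
Unset Printing Implicit Defensive.
Local Open Scope classical_set_scope.
Local Open Scope ring_scope.

(** Both parts rest on one quantitative fact about a single projected gradient
    step [z] from a feasible point [y], with residual [r] at [y]. The
    complementarity set is a product of unions of two half-lines, and its
    projection acts pair by pair. Reading the optimality of the pair [(u_i, v_i)] off its branch in [z]
    produces a diagonal [D] with entries in [[-1, 1]] such that
    [alpha |(A - B D)^T r| <= |z - y|] ([projected_step_certificate]). If all the
    matrices [(A - B D)^T] are bounded below by the same [sigma > 0], this becomes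
    the error bound [alpha sigma |r| <= |z - y|] ([residual_error_bound]).

    At a stationary point [z = y], hence [r = 0]. Along the algorithm, the error
    bound and the sufficient decrease of the objective
    ([projected_step_descent]) combine into
    [Phi(z) <= (1 - alpha (1 - alpha L) sigma^2) Phi(y)]
    ([projected_step_contraction]). A refinement candidate is accepted only if it
    does not increase [Phi], so [Phi(y^k)] decays geometrically
    ([spg_Phi_cvg0]). When the iterates are bounded, compactness turns this decay
    into convergence of the distance to the solution set
    ([bounded_near_cluster]).

    The bound [sigma] comes from the smallest singular value: for [m <= n] one
    has [sigma_min(W) |z| <= |W^T z|] ([sigma_min_le_enorm_tr]), because the
    minimum of the right-hand side over the unit sphere is attained, at an
    eigenvector of [W W^T]. Thus [sigma] may be the infimum of part (a), or the
    gap [sigma_min(A) - |B|] of part (b).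

    In part (b), the map [x |-> A x - B |x|] expands distances by at least that
    gap ([gave_residual_expansive]). This gives uniqueness, and it turns
    convergence of the residuals to [0] into convergence of the iterates.
    Existence holds because the norm of the residual attains its minimum, and the
    fixed-point step [A^-1 (B |x| + b)] would decrease a nonzero minimum
    ([gave_solution_exists]). *)

(** * Inner product, Euclidean norm and spectral norm *)

Definition dot (R : realType) (N : nat) (x y : 'cV[R]_N) : R :=
  (x^T *m y) 0 0.

Lemma dotE (R : realType) (N : nat) (x y : 'cV[R]_N) :
  dot x y = \sum_i x i 0 * y i 0.
Proof. by rewrite /dot mxE; apply: eq_bigr => i _; rewrite mxE. Qed.

Lemma dotC (R : realType) (N : nat) (x y : 'cV[R]_N) : dot x y = dot y x.
Proof. by rewrite !dotE; apply: eq_bigr => i _; rewrite mulrC. Qed.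

Lemma dotDl (R : realType) (N : nat) (x y z : 'cV[R]_N) :
  dot (x + y) z = dot x z + dot y z.
Proof. by rewrite /dot linearD /= mulmxDl mxE. Qed.

Lemma dotZl (R : realType) (N : nat) (a : R) (x y : 'cV[R]_N) :
  dot (a *: x) y = a * dot x y.
Proof. by rewrite /dot linearZ /= -scalemxAl mxE. Qed.

Lemma dotDr (R : realType) (N : nat) (x y z : 'cV[R]_N) :
  dot z (x + y) = dot z x + dot z y.
Proof. by rewrite dotC dotDl !(dotC z). Qed.

Lemma dotZr (R : realType) (N : nat) (a : R) (x y : 'cV[R]_N) :
  dot x (a *: y) = a * dot x y.
Proof. by rewrite dotC dotZl dotC. Qed.

Lemma dotNl (R : realType) (N : nat) (x y : 'cV[R]_N) :
  dot (- x) y = - dot x y.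
Proof. by rewrite -scaleN1r dotZl mulN1r. Qed.

Lemma dotNr (R : realType) (N : nat) (x y : 'cV[R]_N) :
  dot x (- y) = - dot x y.
Proof. by rewrite -scaleN1r dotZr mulN1r. Qed.

Lemma dot_adj (R : realType) (M N : nat) (W : 'M[R]_(M, N)) x z :
  dot (W *m x) z = dot x (W^T *m z).
Proof. by rewrite /dot trmx_mul mulmxA. Qed.

Lemma enorm_ge0 (R : realType) (N : nat) (x : 'cV[R]_N) : 0 <= enorm x.
Proof. exact: sqrtr_ge0. Qed.

Lemma enorm_sqr (R : realType) (N : nat) (x : 'cV[R]_N) :
  enorm x ^+ 2 = dot x x.
Proof.
rewrite dotE sqr_sqrtr; first by apply: eq_bigr => i _; rewrite expr2.
by apply: sumr_ge0 => i _; apply: sqr_ge0.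
Qed.

Lemma dot_ge0 (R : realType) (N : nat) (x : 'cV[R]_N) : 0 <= dot x x.
Proof. by rewrite -enorm_sqr sqr_ge0. Qed.

Lemma coord_le_enorm (R : realType) (N : nat) (x : 'cV[R]_N) i :
  `|x i 0| <= enorm x.
Proof.
rewrite -(@ler_pXn2r _ 2) ?nnegrE ?enorm_ge0 //.
rewrite enorm_sqr real_normK ?num_real // dotE (bigD1 i) //= expr2 lerDl.
by apply: sumr_ge0 => j _; rewrite -expr2 sqr_ge0.
Qed.

Lemma enorm_eq0 (R : realType) (N : nat) (x : 'cV[R]_N) :
  enorm x = 0 -> x = 0.
Proof.
move=> x0; apply/colP => i; rewrite mxE.
by apply/eqP; rewrite -normr_le0 -x0 coord_le_enorm.
Qed.

Lemma enorm0 (R : realType) (N : nat) : enorm (0 : 'cV[R]_N) = 0.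
Proof.
apply/eqP; rewrite -sqrf_eq0 enorm_sqr dotE big1 // => i _.
by rewrite mxE mul0r.
Qed.

Lemma enormZ (R : realType) (N : nat) (a : R) (x : 'cV[R]_N) :
  enorm (a *: x) = `|a| * enorm x.
Proof.
apply/eqP; rewrite -(@eqrXn2 _ 2) ?mulr_ge0 ?enorm_ge0 //.
rewrite exprMn !enorm_sqr dotZl dotZr real_normK ?num_real //.
by rewrite mulrA expr2.
Qed.

Lemma enormN (R : realType) (N : nat) (x : 'cV[R]_N) :
  enorm (- x) = enorm x.
Proof. by rewrite -scaleN1r enormZ normrN1 mul1r. Qed.

Lemma enormB (R : realType) (N : nat) (x y : 'cV[R]_N) :
  enorm (x - y) = enorm (y - x).
Proof. by rewrite -enormN opprB. Qed.

(** Nonnegativity of the square norm of [|y|^2 x - <x,y> y] is the inequality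
    multiplied by [|y|^2]. *)
Lemma cauchy_schwarz (R : realType) (N : nat) (x y : 'cV[R]_N) :
  dot x y <= enorm x * enorm y.
Proof.
have [y0|y0] := eqVneq (enorm y) 0.
  by rewrite (enorm_eq0 y0) enorm0 mulr0 dotC -(scale0r 0) dotZl mul0r.
have ypos : 0 < dot y y.
  by rewrite -enorm_sqr exprn_gt0 // lt_def y0 enorm_ge0.
apply: le_trans (ler_norm _) _.
rewrite -(@ler_pXn2r _ 2) ?nnegrE ?mulr_ge0 ?enorm_ge0 //.
rewrite real_normK ?num_real // exprMn !enorm_sqr.
have := dot_ge0 (dot y y *: x - dot x y *: y).
rewrite !(dotDl, dotDr, dotNl, dotNr, dotZl, dotZr) (dotC y x) => H.
rewrite -subr_ge0 -(pmulr_rge0 _ ypos).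
by apply: le_trans H _; rewrite le_eqVlt; apply/orP; left; apply/eqP; ring.
Qed.

Lemma enorm_triangle (R : realType) (N : nat) (x y : 'cV[R]_N) :
  enorm (x + y) <= enorm x + enorm y.
Proof.
rewrite -(@ler_pXn2r _ 2) ?nnegrE ?addr_ge0 ?enorm_ge0 //.
rewrite sqrrD !enorm_sqr dotDl !dotDr (dotC y x).
have := cauchy_schwarz x y; lra.
Qed.

Lemma enorm_triangle_sub (R : realType) (N : nat) (x y : 'cV[R]_N) :
  enorm x - enorm y <= enorm (x - y).
Proof. by have := enorm_triangle (x - y) y; rewrite subrK; lra. Qed.

Lemma enorm_le_coord (R : realType) (N : nat) (x y : 'cV[R]_N) :
  (forall i, `|x i 0| <= `|y i 0|) -> enorm x <= enorm y.
Proof.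
move=> xy; rewrite -(@ler_pXn2r _ 2) ?nnegrE ?enorm_ge0 //.
rewrite !enorm_sqr !dotE; apply: ler_sum => i _.
rewrite -!expr2 -(real_normK (num_real (x i 0))).
rewrite -(real_normK (num_real (y i 0))).
by rewrite ler_pXn2r ?nnegrE ?normr_ge0 //.
Qed.

(** The image of the unit ball is bounded, by the Frobenius norm, so that the
    supremum defining the spectral norm is a genuine one. *)
Lemma spectral_norm_has_ubound (R : realType) (M N : nat)
    (W : 'M[R]_(M, N)) :
  has_ubound [set enorm (W *m x) | x in [set x : 'cV[R]_N | enorm x <= 1]].
Proof.
exists (Num.sqrt (\sum_i dot (row i W)^T (row i W)^T)) => _ [x x1 <-].
rewrite /enorm ler_sqrt; last by apply: sumr_ge0 => i _; apply: dot_ge0.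
apply: ler_sum => i _.
have -> : (W *m x) i 0 = dot (row i W)^T x.
  by rewrite dotE mxE; apply: eq_bigr => j _; rewrite !mxE.
have Hd : `|dot (row i W)^T x| <= enorm (row i W)^T * enorm x.
  rewrite ler_norml cauchy_schwarz andbT lerNl -dotNr.
  by apply: le_trans (cauchy_schwarz _ _) _; rewrite enormN.
rewrite -(real_normK (num_real (dot _ _))) -enorm_sqr.
rewrite ler_pXn2r ?nnegrE ?normr_ge0 ?enorm_ge0 //.
by apply: le_trans Hd _; rewrite ler_piMr ?enorm_ge0.
Qed.

Lemma enorm_mulmx (R : realType) (M N : nat) (W : 'M[R]_(M, N)) x :
  enorm (W *m x) <= spectral_norm W * enorm x.
Proof.
have [x0|x0] := eqVneq (enorm x) 0.
  by rewrite (enorm_eq0 x0) mulmx0 !enorm0 mulr0.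
have xpos : 0 < enorm x by rewrite lt_def x0 enorm_ge0.
rewrite -ler_pdivrMr //.
apply: (ub_le_sup (spectral_norm_has_ubound W)).
exists ((enorm x)^-1 *: x) => /=.
  by rewrite enormZ ger0_norm ?invr_ge0 ?enorm_ge0 // mulVf.
by rewrite -scalemxAr enormZ ger0_norm ?invr_ge0 ?enorm_ge0 // mulrC.
Qed.

Lemma spectral_norm_ge0 (R : realType) (M N : nat) (W : 'M[R]_(M, N)) :
  0 <= spectral_norm W.
Proof.
apply: (ub_le_sup (spectral_norm_has_ubound W)).
by exists 0; rewrite /= ?mulmx0 enorm0.
Qed.

(** A matrix and its transpose have the same spectral norm; this half of the
    equality is [|W^T z|^2 = <W W^T z, z>]. *)
Lemma enorm_tr_mulmx (R : realType) (M N : nat) (W : 'M[R]_(M, N)) z :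
  enorm (W^T *m z) <= spectral_norm W * enorm z.
Proof.
have [x0|x0] := eqVneq (enorm (W^T *m z)) 0.
  by rewrite x0 mulr_ge0 ?spectral_norm_ge0 ?enorm_ge0.
have xpos : 0 < enorm (W^T *m z) by rewrite lt_def x0 enorm_ge0.
rewrite -(ler_pM2r xpos) -expr2 enorm_sqr -dot_adj.
apply: le_trans (cauchy_schwarz _ _) _.
have := enorm_mulmx W (W^T *m z) => /(ler_wpM2r (enorm_ge0 z)) H.
by rewrite mulrAC.
Qed.

(** * Topology of the Euclidean norm *)

Lemma enorm_le_norm (R : realType) (N : nat) (x : 'cV[R]_N) :
  enorm x <= Num.sqrt N%:R * `|x|.
Proof.
rewrite -(@ler_pXn2r _ 2) ?nnegrE ?mulr_ge0 ?sqrtr_ge0 ?enorm_ge0 //.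
rewrite enorm_sqr dotE exprMn sqr_sqrtr ?ler0n //.
have -> : N%:R * `|x| ^+ 2 = \sum_(i < N) `|x| ^+ 2.
  by rewrite sumr_const card_ord mulr_natl.
apply: ler_sum => i _; rewrite -expr2 -(real_normK (num_real (x i 0))).
rewrite ler_pXn2r ?nnegrE ?normr_ge0 // [leRHS]/Num.norm /= mx_normrE.
by apply/bigmax_geP; right; exists (i, 0).
Qed.

(** Continuity is for the topology of the sup norm, which controls the Euclidean
    norm up to the factor [sqrt N]. *)
Lemma enorm_lipschitz_continuous (R : realType) (N : nat) (K : R)
    (f : 'cV[R]_N -> R) :
  (forall x y, f x - f y <= K * enorm (x - y)) -> continuous f.
Proof.
move=> fK x; apply: (@cvgrPdist_lt _ _ _ _ (nbhs_filter x) f (f x)).2 => e e0.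
pose C := `|K| * Num.sqrt N%:R + 1.
have C0 : 0 < C by rewrite ltr_wpDl // mulr_ge0 // sqrtr_ge0.
near=> y.
have xy : `|x - y| < e / C.
  near: y; have /cvgrPdist_lt : id @ nbhs x --> x by exact: cvg_id.
  by apply; exact: divr_gt0.
have H : `|f x - f y| <= `|K| * enorm (x - y).
  have HK z : K * enorm z <= `|K| * enorm z.
    by rewrite ler_wpM2r ?enorm_ge0 // ler_norm.
  rewrite ler_norml; apply/andP; split.
    by rewrite lerNl opprB (le_trans (fK y x)) // enormB.
  by apply: le_trans (fK x y) _.
apply: le_lt_trans H _.
apply: (@le_lt_trans _ _ (C * `|x - y|)).
  apply: (@le_trans _ _ (`|K| * (Num.sqrt N%:R * `|x - y|))).
    by rewrite ler_wpM2l // enorm_le_norm.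
  by rewrite mulrA ler_wpM2r // lerDl.
by rewrite mulrC -ltr_pdivlMr.
Unshelve. all: by end_near. Qed.

Lemma enorm_continuous (R : realType) (N : nat) :
  continuous (@enorm R N).
Proof.
apply: (@enorm_lipschitz_continuous _ _ 1) => x y.
by rewrite mul1r enorm_triangle_sub.
Qed.

Lemma enorm_affine_continuous (R : realType) (M N : nat) (W : 'M[R]_(M, N))
    (c : 'cV[R]_M) :
  continuous (fun x => enorm (W *m x - c)).
Proof.
apply: (@enorm_lipschitz_continuous _ _ (spectral_norm W)) => x y.
apply: le_trans (enorm_triangle_sub _ _) _.
by rewrite opprB addrA subrK -mulmxBr enorm_mulmx.
Qed.

Lemma trmx_continuous (R : realType) (M N : nat) :
  continuous (@trmx R M N).
Proof.
move=> x s /= /(nbhs_ballP x^T) [e e0 es].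
apply/nbhs_ballP; exists e => //= y [? xy]; apply: es.
by split => // i j; rewrite !mxE; exact: xy.
Qed.

(** Heine-Borel, transported along the transposition from row vectors. *)
Lemma enorm_bounded_closed_compact (R : realType) (N : nat) (M : R)
    (A : set 'cV[R]_N) :
  closed A -> (forall x, A x -> enorm x <= M) -> compact A.
Proof.
move=> Acl AM.
have -> : A = trmx @` (trmx @^-1` A : set 'rV[R]_N).
  apply/seteqP; split=> [x Ax|_ [x Ax <-] //].
  by exists x^T => /=; rewrite trmxK.
apply: continuous_compact.
  by apply: continuous_subspaceT => x; apply: trmx_continuous.
apply: bounded_closed_compact; last first.
  by apply: closed_comp => // x _; apply: trmx_continuous.
exists M; split=> [|K MK x Ax]; first exact: num_real.
apply: le_trans (ltW MK); apply: le_trans (AM _ Ax).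
rewrite [leLHS]/Num.norm /= mx_normrE; apply: bigmax_le; first exact: enorm_ge0.
by move=> [i j] _ /=; have := coord_le_enorm x^T j; rewrite mxE ord1.
Qed.

(** * Variational bound for the smallest singular value *)

(** The quadratic form [q] of [G = W W^T - lambda I] is nonnegative and vanishes
    at [x], so that along a line [x + t h] it equals [2 t <h, G x> + t^2 q(h)];
    a nonnegative function of this form has no linear term. Taking [h = G x]
    gives [G x = 0]. *)
Lemma rayleigh_minimizer_eigenvector (R : realType) (m n : nat)
    (W : 'M[R]_(m, n)) (lambda : R) (x : 'cV[R]_m) :
  (forall z, lambda * dot z z <= dot (W^T *m z) (W^T *m z)) ->
  lambda * dot x x = dot (W^T *m x) (W^T *m x) ->
  W *m (W^T *m x) = lambda *: x.
Proof.
move=> lb eqx; apply/eqP; rewrite -subr_eq0; apply/eqP/enorm_eq0.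
set h := W *m _ - _.
have hh : dot h h = dot (W^T *m x) (W^T *m h) - lambda * dot x h.
  by rewrite {1}/h dotDl dotNl dotZl dot_adj.
clearbody h.
pose q := dot (W^T *m h) (W^T *m h) - lambda * dot h h.
have q0 : 0 <= q by rewrite subr_ge0.
have line t : 0 <= 2 * t * dot h h + t ^+ 2 * q.
  have := lb (x + t *: h); rewrite mulmxDr -scalemxAr.
  rewrite !(dotDl, dotDr, dotZl, dotZr) (dotC h x) (dotC (W^T *m h)).
  by rewrite -eqx hh /q; move=> H; rewrite -subr_ge0 in H; move: H; nra.
have h0 := dot_ge0 h.
apply/eqP; rewrite -sqrf_eq0 enorm_sqr eq_le h0 andbT.
(* The minimizer would be [- <h, h> / q]; the shift by one covers [q = 0]. *)
have := line (- (dot h h / (q + 1))).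
set a := dot h h in h0 *.
have q1 : q + 1 != 0 by rewrite gt_eqF // ltr_wpDl.
have -> : 2 * - (a / (q + 1)) * a + (- (a / (q + 1))) ^+ 2 * q =
          - (a ^+ 2 * (q + 2) / (q + 1) ^+ 2).
  by field.
rewrite oppr_ge0 pmulr_lle0 ?invr_gt0 ?exprn_gt0 // ?ltr_wpDl //.
rewrite pmulr_lle0 ?ltr_wpDl // => Ha.
by rewrite -(@ler_pXn2r _ 2) ?nnegrE // expr0n.
Qed.

(** The infimum of [|W^T x|] over the unit sphere is attained; its square is
    an eigenvalue of [W W^T], so that the infimum is a singular value. *)
Lemma sigma_min_le_enorm_tr (R : realType) (m n : nat) (W : 'M[R]_(m, n))
    (z : 'cV[R]_m) :
  (m <= n)%N -> sigma_min W * enorm z <= enorm (W^T *m z).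
Proof.
move=> mn; have [z0|z0] := eqVneq (enorm z) 0.
  by rewrite z0 mulr0 enorm_ge0.
have zpos : 0 < enorm z by rewrite lt_def z0 enorm_ge0.
pose sph := [set x : 'cV[R]_m | enorm x = 1].
have unit_sph (x : 'cV[R]_m) : 0 < enorm x -> sph ((enorm x)^-1 *: x).
  move=> x0; rewrite /sph /= enormZ ger0_norm ?invr_ge0 ?enorm_ge0 //.
  by rewrite mulVf ?gt_eqF.
have sph_compact : compact sph.
  apply: (@enorm_bounded_closed_compact _ _ 1) => [|x ->//].
  have -> : sph = @enorm R m @^-1` [set 1].
    by apply/seteqP; split.
  apply: closed_comp; last exact: closed_eq.
  by move=> x _; apply: enorm_continuous.
have cf : {within sph, continuous (fun x => enorm (W^T *m x - 0))}.
  by apply: continuous_subspaceT; apply: enorm_affine_continuous.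
have [|x0] := @compact_EVT_min _ R _ sph _ sph_compact cf.
  by exists ((enorm z)^-1 *: z); apply: unit_sph.
rewrite inE subr0 => x0sph x0min.
set s := enorm (W^T *m x0) in x0min.
have lb x : s * enorm x <= enorm (W^T *m x).
  have [->|nx] := eqVneq x 0; first by rewrite enorm0 mulr0 enorm_ge0.
  have xpos : 0 < enorm x.
    by rewrite lt_def enorm_ge0 andbT; apply: contra_neq nx => /enorm_eq0.
  have := x0min ((enorm x)^-1 *: x); rewrite inE => /(_ (unit_sph _ xpos)).
  rewrite subr0 -scalemxAr enormZ ger0_norm ?invr_ge0 ?enorm_ge0 //.
  by rewrite -ler_pdivlMr // mulrC.
have eig : W *m (W^T *m x0) = s ^+ 2 *: x0.
  apply: rayleigh_minimizer_eigenvector => [x|].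
    rewrite -!enorm_sqr -exprMn ler_pXn2r ?nnegrE ?mulr_ge0 ?enorm_ge0 //.
  by rewrite -!enorm_sqr x0sph expr1n mulr1.
apply: le_trans (lb z); rewrite ler_wpM2r ?enorm_ge0 //.
apply: ge_inf; first by exists 0 => t [].
split; first exact: enorm_ge0.
rewrite mn; apply/eigenvalueP; exists x0^T.
  by rewrite -linearZ /= -eig !trmx_mul trmxK mulmxA.
rewrite -(inj_eq (@trmx_inj _ _ _)) trmxK trmx0.
by apply: contra_eq_neq x0sph => ->; rewrite enorm0 eq_sym oner_eq0.
Qed.

Lemma sigma_min_gt0_unitmx (R : realType) (n : nat) (A : 'M[R]_n) :
  0 < sigma_min A -> A \in unitmx.
Proof.
move=> s0; rewrite -row_free_unit; apply: inj_row_free => v vA.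
apply: trmx_inj; rewrite trmx0; apply: enorm_eq0.
apply/eqP; rewrite eq_le enorm_ge0 andbT -(pmulr_rle0 _ s0).
apply: le_trans (sigma_min_le_enorm_tr A _ (leqnn n)) _.
by rewrite -trmx_mul vA trmx0 enorm0.
Qed.

(** For an invertible square matrix a lower bound on the transpose passes to
    the matrix: write [x = A^T z] in [|x|^2 = <z, A x>]. *)
Lemma sigma_min_le_enorm (R : realType) (n : nat) (A : 'M[R]_n) (x : 'cV[R]_n) :
  0 < sigma_min A -> sigma_min A * enorm x <= enorm (A *m x).
Proof.
move=> s0; have AT z := sigma_min_le_enorm_tr A z (leqnn n).
have Au := sigma_min_gt0_unitmx s0.
have [x0|x0] := eqVneq (enorm x) 0; first by rewrite x0 mulr0 enorm_ge0.
have xpos : 0 < enorm x by rewrite lt_def x0 enorm_ge0.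
pose z := invmx A^T *m x.
have xz : A^T *m z = x by rewrite mulmxA mulmxV ?unitmx_tr // mul1mx.
have := AT z; rewrite xz => zx.
have : enorm x ^+ 2 <= enorm z * enorm (A *m x).
  by rewrite enorm_sqr -{1}xz dot_adj trmxK cauchy_schwarz.
move=> /(ler_wpM2l (ltW s0)) H; rewrite -(ler_pM2r xpos) -mulrA -expr2.
apply: le_trans H _; rewrite mulrA [leRHS]mulrC ler_wpM2r ?enorm_ge0 //.
Qed.

(** * Projection onto the complementarity set and the error bound *)

(** Moving one coordinate along its half-line changes the squared distance to [p]
    by a function of that coordinate alone, so that [z j 0] solves the
    one-dimensional problem of projecting [p j 0] onto the half-line. *)
Lemma proj_coordE (R : realType) (N : nat) (Omega : set 'cV[R]_N)
    (p z : 'cV[R]_N) (j : 'I_N) :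
  Defs.proj Omega p z -> 0 <= z j 0 ->
  (forall t, 0 <= t -> Omega (z + (t - z j 0) *: delta_mx j 0)) ->
  z j 0 = Num.max (p j 0) 0.
Proof.
move=> [_ zmin] zj0 move_j.
have dotd x : dot (delta_mx j 0 : 'cV[R]_N) x = x j 0.
  rewrite dotE (bigD1 j) //= mxE !eqxx mul1r big1 ?addr0 // => i ij.
  by rewrite mxE (negbTE ij) mul0r.
have key t : 0 <= t ->
    0 <= (t - z j 0) ^+ 2 - 2 * (t - z j 0) * (p j 0 - z j 0).
  move=> t0; have := zmin _ (move_j t t0).
  rewrite -(@ler_pXn2r _ 2) ?nnegrE ?enorm_ge0 // !enorm_sqr.
  rewrite opprD addrA; set x := p - z; set d := delta_mx j 0.
  rewrite [dot (x - _) _]dotDl !dotNl !dotDr !dotNr !dotZl !dotZr.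
  rewrite (dotC x d) !dotd !mxE !eqxx /= mulr1; lra.
have [p0|p0] := leP (p j 0) 0.
  by have := key 0 (lexx _); nra.
by have := key _ (ltW p0); nra.
Qed.

Lemma compl_set_move_u (R : realType) (n : nat) (y : 'cV[R]_(n + n)) i t :
  compl_set y -> y (rshift n i) 0 = 0 -> 0 <= t ->
  compl_set (y + (t - y (lshift n i) 0) *: delta_mx (lshift n i) 0).
Proof.
move=> yC vi t0 k; have [+ + +] := yC k; rewrite !mxE eq_rlshift /= mulr0.
rewrite addr0 eq_lshift andbT.
have [->|_] := eqVneq k i; last first.
  by rewrite mulr0 addr0 => ? ? ?; split.
rewrite vi mulr1 mulr0 addrC subrK => ? ? ?.
by split; rewrite ?mulr0.
Qed.

Lemma compl_set_move_v (R : realType) (n : nat) (y : 'cV[R]_(n + n)) i t :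
  compl_set y -> y (lshift n i) 0 = 0 -> 0 <= t ->
  compl_set (y + (t - y (rshift n i) 0) *: delta_mx (rshift n i) 0).
Proof.
move=> yC vi t0 k; have [+ + +] := yC k; rewrite !mxE eq_lrshift /= mulr0.
rewrite addr0 eq_rshift andbT.
have [->|_] := eqVneq k i; last first.
  by rewrite mulr0 addr0 => ? ? ?; split.
rewrite vi mulr1 mul0r addrC subrK => ? ? ?.
by split; rewrite ?mul0r.
Qed.

Lemma proj_compl_setE (R : realType) (n : nat) (p z : 'cV[R]_(n + n)) i :
  Defs.proj (@compl_set R n) p z ->
  (z (rshift n i) 0 = 0 ->
     z (lshift n i) 0 = Num.max (p (lshift n i) 0) 0) /\
  (z (lshift n i) 0 = 0 ->
     z (rshift n i) 0 = Num.max (p (rshift n i) 0) 0).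
Proof.
move=> zp; have zC := zp.1; have := zC i; rewrite !mxE => -[u0 v0 _].
split=> zi; apply: (proj_coordE zp) => // t t0.
  exact: compl_set_move_u.
exact: compl_set_move_v.
Qed.

Lemma eq_max0 (R : realType) (w x : R) : w = Num.max x 0 ->
  w = 0 /\ x <= 0 \/ 0 < w /\ w = x.
Proof. by case: (leP x 0) => x0 ->; [left|right]. Qed.

(** One diagonal entry of the certificate. Here [a] and [b] stand for the entries
    of [A^T r] and [B^T r], so that [a - b] and [- a - b] are the partial
    gradients in [u] and [v]. On the branch [u' > 0] the displacement of [u] is
    exactly [alpha (a - b)], which is [d = 1]; symmetrically [d = -1] on the
    branch [v' > 0]. At [u' = v' = 0] both partial gradients are nonnegative,
    which means [|a| <= - b], and some [d] makes [a - d b] vanish. *)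
Lemma unit_diag_entry (R : realType) (alpha a b u v u' v' : R) :
  0 < alpha -> 0 <= u -> 0 <= v -> 0 <= u' -> 0 <= v' -> u' * v' = 0 ->
  (v' = 0 -> u' = Num.max (u - alpha * (a - b)) 0) ->
  (u' = 0 -> v' = Num.max (v - alpha * (- a - b)) 0) ->
  exists d, -1 <= d <= 1 /\
    (alpha * (a - d * b)) ^+ 2 <= (u' - u) ^+ 2 + (v' - v) ^+ 2.
Proof.
move=> al0 u0 v0 u'0 v'0 uv hu hv.
have [u'z|u'p] := eqVneq u' 0; last first.
  have v'z : v' = 0.
    by move/eqP: uv; rewrite mulf_eq0 (negbTE u'p) => /eqP.
  exists 1; split; first by rewrite lexx andbT lerNl; lra.
  have [[u'z _]|[_ Hu]] := eq_max0 (hu v'z).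
    by rewrite u'z eqxx in u'p.
  have -> : alpha * (a - 1 * b) = u - u' by rewrite Hu; ring.
  by rewrite -[_ ^+ 2]sqrrN opprB lerDl sqr_ge0.
have [v'z|v'p] := eqVneq v' 0; last first.
  exists (-1); split; first by rewrite lexx /=; lra.
  have [[v'z _]|[_ Hv]] := eq_max0 (hv u'z).
    by rewrite v'z eqxx in v'p.
  have -> : alpha * (a - (-1) * b) = v' - v by rewrite Hv; ring.
  by rewrite lerDr sqr_ge0.
have au : 0 <= alpha * (a - b).
  by have [[_ ?]|[]] := eq_max0 (hu v'z); lra.
have av : 0 <= alpha * (- a - b).
  by have [[_ ?]|[]] := eq_max0 (hv u'z); lra.
rewrite !pmulr_rge0 // in au av.
have rhs0 : 0 <= (u' - u) ^+ 2 + (v' - v) ^+ 2 by rewrite addr_ge0 ?sqr_ge0.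
have [b0|b0] := eqVneq b 0.
  exists 0; split; first by lra.
  have -> : a = 0 by lra.
  by rewrite mul0r subrr mulr0 expr0n.
have bneg : b < 0 by rewrite lt_neqAle b0; lra.
exists (a / b); split.
  by rewrite ler_ndivlMr // ler_ndivrMr // mulN1r mul1r; apply/andP; split; lra.
by rewrite mulfVK // subrr mulr0 expr0n.
Qed.

Lemma gradPhi_lshift (R : realType) (m n : nat) (A B : 'M[R]_(m, n)) c y i :
  gradPhi (A - B) (- A - B) c y (lshift n i) 0 =
  (A^T *m residual (A - B) (- A - B) c y) i 0 -
  (B^T *m residual (A - B) (- A - B) c y) i 0.
Proof.
rewrite /gradPhi; move: (residual _ _ _ _) => r.
rewrite /Hmx tr_row_mx mul_col_mx col_mxEu linearB /= mulmxBl.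
by rewrite [LHS]mxE [X in _ + X]mxE.
Qed.

Lemma gradPhi_rshift (R : realType) (m n : nat) (A B : 'M[R]_(m, n)) c y i :
  gradPhi (A - B) (- A - B) c y (rshift n i) 0 =
  - (A^T *m residual (A - B) (- A - B) c y) i 0 -
  (B^T *m residual (A - B) (- A - B) c y) i 0.
Proof.
rewrite /gradPhi; move: (residual _ _ _ _) => r.
rewrite /Hmx tr_row_mx mul_col_mx col_mxEd linearB /= linearN /=.
by rewrite mulmxBl mulNmx [LHS]mxE [X in X + _]mxE [X in _ + X]mxE.
Qed.

(** With [D] chosen entry by entry from the branch of [z], each entry of
    [(A - B D)^T r] either is, up to sign, the partial gradient along the
    positive coordinate of the pair, which the step moves without clipping, or
    vanishes. For [z = y], stationarity yields a [D] with [(A - B D)^T r = 0]. *)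
Lemma projected_step_certificate (R : realType) (m n : nat)
    (A B : 'M[R]_(m, n)) (c : 'cV[R]_m) (alpha : R) (y z : 'cV[R]_(n + n)) :
  let r := residual (A - B) (- A - B) c y in
  0 < alpha -> compl_set y ->
  Defs.proj (@compl_set R n) (y - alpha *: gradPhi (A - B) (- A - B) c y) z ->
  exists2 D, unit_diag D &
    alpha * enorm ((A - B *m D)^T *m r) <= enorm (z - y).
Proof.
move=> r al0 yC zp.
pose a i := (A^T *m r) i 0; pose b i := (B^T *m r) i 0.
have /choice[d hd] : forall i : 'I_n, exists d, -1 <= d <= 1 /\
    (alpha * (a i - d * b i)) ^+ 2 <=
    (z (lshift n i) 0 - y (lshift n i) 0) ^+ 2 +
    (z (rshift n i) 0 - y (rshift n i) 0) ^+ 2.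
  move=> i; have := yC i; rewrite !mxE => -[u0 v0 _].
  have := zp.1 i; rewrite !mxE => -[u'0 v'0 uv'].
  have [hu hv] := proj_compl_setE i zp.
  apply: unit_diag_entry => // [/hu|/hv] ->; congr Num.max;
    rewrite [LHS]mxE [X in _ + X]mxE [X in - X]mxE.
    by rewrite gradPhi_lshift.
  by rewrite gradPhi_rshift.
exists (diag_mx (\row_i d i)).
  split=> [|i]; first exact: diag_mx_is_diag.
  by rewrite !mxE eqxx mulr1n; have [] := hd i.
rewrite -[alpha]gtr0_norm // -enormZ.
rewrite -(@ler_pXn2r _ 2) ?nnegrE ?enorm_ge0 // !enorm_sqr !dotE.
rewrite big_split_ord /= -big_split /=; apply: ler_sum => i _.
have -> : (alpha *: ((A - B *m diag_mx (\row_i d i))^T *m r)) i 0 =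
          alpha * (a i - d i * b i).
  rewrite [LHS]mxE /a /b; clearbody r; congr (alpha * _).
  rewrite [(A - _)^T]linearB /= trmx_mul tr_diag_mx mulmxBl -mulmxA.
  by rewrite mul_diag_mx [LHS]mxE [X in _ + X]mxE [X in - X]mxE !mxE.
by rewrite -!expr2 !mxE; have [] := hd i.
Qed.

(** For [sigma > 0], a quantitative form of the surjectivity of all the matrices
    [A - B D], stated on the transposes. *)
Definition uniformly_coercive (R : realType) (m n : nat)
    (A B : 'M[R]_(m, n)) (sigma : R) : Prop :=
  forall D, unit_diag D ->
  forall z, sigma * enorm z <= enorm ((A - B *m D)^T *m z).

Lemma residual_error_bound (R : realType) (m n : nat)
    (A B : 'M[R]_(m, n)) (c : 'cV[R]_m) (sigma alpha : R)
    (y z : 'cV[R]_(n + n)) :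
  uniformly_coercive A B sigma -> 0 < alpha -> compl_set y ->
  Defs.proj (@compl_set R n) (y - alpha *: gradPhi (A - B) (- A - B) c y) z ->
  alpha * (sigma * enorm (residual (A - B) (- A - B) c y)) <= enorm (z - y).
Proof.
move=> co al0 yC /(projected_step_certificate al0 yC)[D uD].
by apply: le_trans; rewrite ler_wpM2l ?(ltW al0) // co.
Qed.

Lemma Phi_ge0 (R : realType) (m n : nat) (P Q : 'M[R]_(m, n)) c y :
  0 <= Phi P Q c y.
Proof. by rewrite /Phi mulr_ge0 ?invr_ge0 ?sqr_ge0. Qed.

Lemma Phi_expand (R : realType) (m n : nat) (P Q : 'M[R]_(m, n)) c y z :
  Phi P Q c z = Phi P Q c y + dot (gradPhi P Q c y) (z - y)
                + 2^-1 * enorm (Hmx P Q *m (z - y)) ^+ 2.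
Proof.
have -> : dot (gradPhi P Q c y) (z - y) =
          dot (residual P Q c y) (Hmx P Q *m (z - y)).
  by rewrite /gradPhi dot_adj trmxK.
rewrite /Phi !enorm_sqr.
have -> : residual P Q c z = residual P Q c y + Hmx P Q *m (z - y).
  by rewrite /residual mulmxBr; apply/colP => i; rewrite !mxE; ring.
move: (residual P Q c y) (Hmx P Q *m (z - y)) => r h.
rewrite dotDl !dotDr (dotC h r); lra.
Qed.

(** The projection [z] is at least as close to the gradient step as the feasible
    point [y], which bounds the linear term of the expansion of [Phi] at [y] by
    [- |z - y|^2 / (2 alpha)]; the quadratic term is at most
    [L |z - y|^2 / 2]. *)
Lemma projected_step_descent (R : realType) (m n : nat)
    (P Q : 'M[R]_(m, n)) (c : 'cV[R]_m) (alpha : R) (y z : 'cV[R]_(n + n)) :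
  0 < alpha -> compl_set y ->
  Defs.proj (@compl_set R n) (y - alpha *: gradPhi P Q c y) z ->
  (1 - alpha * Lconst P Q) * enorm (z - y) ^+ 2 <=
  2 * alpha * (Phi P Q c y - Phi P Q c z).
Proof.
move=> al0 yC [_ /(_ y yC)].
rewrite -(@ler_pXn2r _ 2) ?nnegrE ?enorm_ge0 // !enorm_sqr.
set g := gradPhi _ _ _ _; set w := z - y.
have -> : y - alpha *: g - z = - (w + alpha *: g).
  by apply/colP => i; rewrite !mxE; ring.
have -> : y - alpha *: g - y = - (alpha *: g).
  by apply/colP => i; rewrite !mxE; ring.
rewrite (Phi_expand P Q c y z) -/g -/w; clearbody g w.
rewrite !dotNl !dotNr !opprK dotDl !dotDr (dotC w) !dotZl.
rewrite -enorm_sqr => opt.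
have : enorm (Hmx P Q *m w) ^+ 2 <= Lconst P Q * enorm w ^+ 2.
  rewrite -exprMn ler_pXn2r ?nnegrE ?mulr_ge0 ?enorm_ge0 ?enorm_mulmx //.
  exact: spectral_norm_ge0.
move/(ler_wpM2l (ltW al0)) => Hw; nra.
Qed.

(** The decrease of [Phi] dominates [|z - y|^2], which by the error bound
    dominates [|r|^2], that is [2 Phi(y)]. *)
Lemma projected_step_contraction (R : realType) (m n : nat)
    (A B : 'M[R]_(m, n)) (c : 'cV[R]_m) (sigma alpha : R)
    (y z : 'cV[R]_(n + n)) :
  let P := A - B in let Q := - A - B in
  uniformly_coercive A B sigma -> 0 <= sigma ->
  0 < alpha -> alpha * Lconst P Q <= 1 -> compl_set y ->
  Defs.proj (@compl_set R n) (y - alpha *: gradPhi P Q c y) z ->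
  Phi P Q c z <=
    (1 - alpha * (1 - alpha * Lconst P Q) * sigma ^+ 2) * Phi P Q c y.
Proof.
move=> P Q co s0 al0 aL yC zp.
have desc := projected_step_descent al0 yC zp.
have := residual_error_bound co al0 yC zp.
rewrite -/P -/Q -(@ler_pXn2r _ 2) ?nnegrE ?mulr_ge0 ?enorm_ge0 ?(ltW al0) //.
rewrite !exprMn.
have -> : enorm (residual P Q c y) ^+ 2 = 2 * Phi P Q c y.
  by rewrite /Phi mulrA divff ?mul1r // pnatr_eq0.
have aL' : 0 <= 1 - alpha * Lconst P Q by rewrite subr_ge0.
move=> /(ler_wpM2l aL') /le_trans /(_ desc).
set k := 1 - alpha * _; set F := Phi _ _ _ y; set G := Phi _ _ _ z => H.
rewrite -subr_ge0 -(pmulr_rge0 _ al0) -(@pmulr_rge0 _ 2) //.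
rewrite -subr_ge0 in H.
by apply: le_trans H _; rewrite le_eqVlt; apply/orP; left; apply/eqP; ring.
Qed.

(** * Uniform lower bounds on the matrices A - B D *)

Lemma sigma_min_ge0 (R : realType) (m n : nat) (W : 'M[R]_(m, n)) :
  0 <= sigma_min W.
Proof.
rewrite /sigma_min; have [->|/set0P ne] := eqVneq (singular_values W) set0.
  by rewrite inf0.
by apply: lb_le_inf => // s [].
Qed.

Lemma uniformly_coercive_inf (R : realType) (m n : nat)
    (A B : 'M[R]_(m, n)) :
  (m <= n)%N ->
  uniformly_coercive A B
    (inf [set sigma_min (A - B *m D) | D in @unit_diag R n]).
Proof.
move=> mn D uD z; apply: le_trans (sigma_min_le_enorm_tr _ z mn).
rewrite ler_wpM2r ?enorm_ge0 //; apply: ge_inf; last by exists D.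
by exists 0 => _ [E _ <-]; apply: sigma_min_ge0.
Qed.

Lemma enorm_unit_diag (R : realType) (n : nat) (D : 'M[R]_n) x :
  unit_diag D -> enorm (D^T *m x) <= enorm x.
Proof.
move=> [/diag_mxP[d ->] uD]; apply: enorm_le_coord => i.
rewrite tr_diag_mx mul_diag_mx mxE normrM ler_piMl // ler_norml.
by have := uD i; rewrite mxE eqxx mulr1n.
Qed.

(** [|D| <= 1], so that [B D] perturbs the lower bound [sigma_min A] by at most
    [|B|]. *)
Lemma uniformly_coercive_gap (R : realType) (m n : nat)
    (A B : 'M[R]_(m, n)) :
  (m <= n)%N -> uniformly_coercive A B (sigma_min A - spectral_norm B).
Proof.
move=> mn D uD z.
have -> : (A - B *m D)^T *m z = A^T *m z - D^T *m (B^T *m z).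
  by rewrite [(A - _)^T]linearB /= trmx_mul mulmxBl -mulmxA.
apply: le_trans (enorm_triangle_sub _ _); rewrite mulrBl lerB //.
  exact: sigma_min_le_enorm_tr.
exact: le_trans (enorm_unit_diag _ uD) (enorm_tr_mulmx _ _).
Qed.

(** * Decay of the objective along the algorithm *)

(** The geometric ratio is [1 - kappa] truncated at [0]: when [kappa > 1], a
    nonnegative [f] has to vanish. *)
Lemma geometric_decay_cvg0 (R : realType) (kappa : R) (f : nat -> R) :
  0 < kappa -> (forall k, 0 <= f k) ->
  (forall k, f k.+1 <= (1 - kappa) * f k) ->
  f k @[k --> \oo] --> (0 : R).
Proof.
move=> k0 f0 fS; pose rho := Num.max (1 - kappa) 0.
have rho0 : 0 <= rho by rewrite le_max lexx orbT.
have rho1 : `|rho| < 1.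
  by rewrite ger0_norm // gt_max ltr01 andbT; lra.
have frho k : f k <= geometric (f 0%N) rho k.
  elim: k => [|k IH]; first by rewrite /geometric /= expr0 mulr1.
  apply: le_trans (fS k) _; apply: (@le_trans _ _ (rho * f k)).
    by rewrite ler_wpM2r // le_max lexx.
  rewrite /geometric /= exprS mulrCA ler_wpM2l //.
apply: (@squeeze_cvgr _ _ _ _ (cst 0) (geometric (f 0%N) rho)).
- by apply: nearW => k; rewrite f0 frho.
- exact: cvg_cst.
- exact: cvg_geometric.
Qed.

Lemma spg_feasible (R : realType) (m n : nat) (P Q : 'M[R]_(m, n)) c q tau
    alpha y ybar nu cand :
  safeguarded_pg P Q c q tau alpha y ybar nu cand ->
  forall k, compl_set (y k).
Proof.
move=> spg [|k]; first exact: spg_init spg.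
rewrite (spg_step spg); have [ybC _] := spg_ybar spg k.
by case: (cand _) => [yh|//]; case: asboolP => [[_ []]|].
Qed.

Lemma spg_Phi_le (R : realType) (m n : nat) (P Q : 'M[R]_(m, n)) c q tau
    alpha y ybar nu cand :
  safeguarded_pg P Q c q tau alpha y ybar nu cand ->
  forall k, Phi P Q c (y k.+1) <= Phi P Q c (ybar k.+1).
Proof.
move=> spg k; rewrite (spg_step spg).
by case: (cand _) => [yh|//]; case: asboolP => [[_ []]|].
Qed.

(** Refinement steps never increase the objective, so they inherit the
    contraction of the projected gradient step, whose factor is uniform for
    step sizes bounded away from [0] and [1 / L]. *)
Lemma spg_Phi_cvg0 (R : realType) (m n : nat) (A B : 'M[R]_(m, n)) c sigma
    alpha y :
  let P := A - B in let Q := - A - B in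
  uniformly_coercive A B sigma -> 0 < sigma ->
  generated_by_spg P Q c alpha y ->
  admissible_steps (Lconst P Q) alpha ->
  Phi P Q c (y k) @[k --> \oo] --> (0 : R).
Proof.
move=> P Q co s0 [q [tau [ybar [nu [cand spg]]]]] [alo [ahi [alo0 ahiL al]]].
have L0 : 0 < Lconst P Q.
  have : 0 < 1 / Lconst P Q.
    have /andP[a1 a2] := al 0%N.
    exact: lt_trans (lt_le_trans alo0 (le_trans a1 a2)) ahiL.
  by rewrite div1r invr_gt0.
have ahiL1 : ahi * Lconst P Q < 1 by rewrite -ltr_pdivlMr.
apply: (@geometric_decay_cvg0 _
  (alo * (1 - ahi * Lconst P Q) * sigma ^+ 2)).
- by rewrite !mulr_gt0 ?exprn_gt0 // subr_gt0.
- by move=> k; apply: Phi_ge0.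
move=> k; have /andP[alk ahk] := al k.
have ak0 : 0 < alpha k by exact: spg_alpha spg k.
have akL : alpha k * Lconst P Q <= ahi * Lconst P Q.
  by rewrite ler_wpM2r // ltW.
apply: le_trans (spg_Phi_le spg k) _.
apply: le_trans (projected_step_contraction co (ltW s0) ak0 _
  (spg_feasible spg k) (spg_ybar spg k)) _.
  exact: le_trans akL (ltW ahiL1).
rewrite ler_wpM2r ?Phi_ge0 // lerB // ler_wpM2r ?sqr_ge0 //.
apply: ler_pM alk _; [exact: ltW| |by rewrite lerB].
by rewrite subr_ge0 ltW.
Qed.

Lemma stationary_residual0 (R : realType) (m n : nat) (A B : 'M[R]_(m, n)) c
    sigma alpha y :
  let P := A - B in let Q := - A - B in
  uniformly_coercive A B sigma -> 0 < sigma -> 0 < alpha ->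
  proj_stationary P Q c alpha y -> residual P Q c y = 0.
Proof.
move=> P Q co s0 al0 [yC yp]; apply: enorm_eq0.
have := residual_error_bound co al0 yC yp.
rewrite subrr enorm0 !pmulr_rle0 // => H.
by apply/eqP; rewrite eq_le H enorm_ge0.
Qed.

(** * Cluster points and distance to the solution set *)

Lemma closed_filter_cluster (T : topologicalType) (F : set_system T)
    (A : set T) :
  closed A -> F A -> cluster F `<=` A.
Proof. by move=> Acl FA p Fp; apply: Acl => U pU; apply: Fp. Qed.

Lemma compl_set_closed (R : realType) (n : nat) : closed (@compl_set R n).
Proof.
have coord (j : 'I_(n + n)) : continuous (fun y : 'cV[R]_(n + n) => y j 0).
  exact: coord_continuous.
have -> : @compl_set R n = \bigcap_(i in [set: 'I_n])
    ((fun y : 'cV[R]_(n + n) => y (lshift n i) 0) @^-1` [set t | 0 <= t] `&`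
    ((fun y : 'cV[R]_(n + n) => y (rshift n i) 0) @^-1` [set t | 0 <= t] `&`
     (fun y : 'cV[R]_(n + n) => y (lshift n i) 0 * y (rshift n i) 0)
       @^-1` [set t | t = 0])).
  apply/seteqP; split=> [y yC i _|y yC i].
    by have := yC i; rewrite !mxE => -[].
  by have [? []] := yC i I; rewrite !mxE.
apply: closed_bigI => i _; apply: closedI; last apply: closedI.
- by apply: closed_comp (@closed_ge _ _) => y _; apply: coord.
- by apply: closed_comp (@closed_ge _ _) => y _; apply: coord.
- apply: closed_comp (@closed_eq _ _) => y _.
  by apply: continuousM; apply: coord.
Qed.

Lemma Phi_cvg0_residual_near (R : realType) (m n : nat) (P Q : 'M[R]_(m, n))
    c y :
  Phi P Q c (y k) @[k --> \oo] --> (0 : R) ->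
  forall e : R, 0 < e ->
  \forall k \near \oo, enorm (residual P Q c (y k)) <= e.
Proof.
move=> Py e e0.
have e2 : 0 < 2^-1 * e ^+ 2 by rewrite mulr_gt0 ?invr_gt0 ?exprn_gt0.
move/cvgr0Pnorm_le: Py => /(_ _ e2); apply: filterS => k.
rewrite ger0_norm ?Phi_ge0 // /Phi ler_pM2l ?invr_gt0 //.
by rewrite ler_pXn2r ?nnegrE ?enorm_ge0 ?(ltW e0).
Qed.

Lemma cluster_sol_set (R : realType) (m n : nat) (P Q : 'M[R]_(m, n)) c y :
  (forall k, compl_set (y k)) ->
  Phi P Q c (y k) @[k --> \oo] --> (0 : R) ->
  cluster (y k @[k --> \oo]) `<=` sol_set P Q c.
Proof.
move=> yC Py p yp; split.
  have yCn : \forall k \near \oo, compl_set (y k) by exact: nearW.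
  exact: (closed_filter_cluster (@compl_set_closed R n)
           (yCn : (y k @[k --> \oo]) _) yp).
apply: enorm_eq0; apply/eqP; rewrite eq_le enorm_ge0 andbT.
apply/ler_addgt0Pl => e e0; rewrite addr0.
pose S := (fun y => enorm (residual P Q c y)) @^-1` [set t | t <= e].
apply: (@closed_filter_cluster _ _ S) yp; last exact: Phi_cvg0_residual_near.
apply: closed_comp (@closed_le _ _) => x _.
exact: enorm_affine_continuous.
Qed.

(** If the terms at distance at least [e] from [S] recurred, they would accumulate
    somewhere by compactness. The limit is a cluster point of the whole sequence,
    hence in [S], although it is a limit of points far from [S]. *)
Lemma bounded_near_cluster (R : realType) (N : nat) (y : nat -> 'cV[R]_N)
    (S : set 'cV[R]_N) :
  bounded_seq y -> cluster (y k @[k --> \oo]) `<=` S ->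
  forall e : R, 0 < e ->
  \forall k \near \oo, exists2 z, S z & enorm (y k - z) < e.
Proof.
move=> [M yM] yS e e0.
pose U := [set x | exists2 z, S z & enorm (x - z) < e].
have [//|notU] := pselect (\forall k \near \oo, U (y k)).
(* The trace of the sequence on the complement of [U] plays the role of a
   subsequence. *)
pose G := within (~` U) (y k @[k --> \oo]).
have GF : ProperFilter G.
  apply: Build_ProperFilter.
  move=> G0; apply: notU.
  apply: (filterS _ (G0 : \forall k \near \oo, ~ U (y k) -> False)) => k.
  exact: contrapT.
have GK : G [set x | enorm x <= M].
  apply: (@nearW _ \oo (fun k => ~ U (y k) -> enorm (y k) <= M)) => k _.
  exact: yM.
have Kc : compact [set x : 'cV[R]_N | enorm x <= M].
  apply: (@enorm_bounded_closed_compact _ _ M) => //.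
  apply: closed_comp (@closed_le _ _) => x _; exact: enorm_continuous.
have [p [_ Gp]] := Kc G GF GK.
have Sp : S p.
  apply: yS => V W FV; apply: Gp; move: FV.
  by apply: filterS => x ? _.
have GU : G (~` U).
  by apply: (@nearW _ \oo (fun k => ~ U (y k) -> ~ U (y k))).
have pe : nbhs p [set x | enorm (x - p) < e].
  have := @enorm_affine_continuous R N N 1%:M p p.
  move=> /cvgrPdist_lt /(_ e e0); apply: filterS => x.
  rewrite !mul1mx subrr enorm0 sub0r normrN ger0_norm ?enorm_ge0 //.
have [x [nUx xp]] := Gp _ _ GU pe.
by case: nUx; exists p.
Qed.

Lemma edistance_cvg0 (R : realType) (N : nat) (y : nat -> 'cV[R]_N)
    (S : set 'cV[R]_N) :
  (forall e : R, 0 < e ->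
     \forall k \near \oo, exists2 z, S z & enorm (y k - z) < e) ->
  edistance (y k) S @[k --> \oo] --> 0%E.
Proof.
move=> yS.
have d0 k : (0 <= edistance (y k) S)%E.
  by apply: le_ereal_inf_tmp => _ [z _ <-]; rewrite lee_fin enorm_ge0.
have dlt e : 0 < e -> \forall k \near \oo, (edistance (y k) S < e%:E)%E.
  move=> /yS; apply: filterS => k [z Sz yz].
  apply: (@le_lt_trans _ _ (enorm (y k - z))%:E); last by rewrite lte_fin.
  by apply: ereal_inf_lbound; exists z.
have fin k (e : R) : (edistance (y k) S < e%:E)%E ->
    edistance (y k) S \is a fin_num.
  by move=> de; rewrite ge0_fin_numE // (lt_trans de) // ltry.
apply/fine_cvgP; split; first by have := dlt 1 ltr01; apply: filterS => k /fin.
apply/cvgr0Pnorm_lt => e e0; have := dlt e e0; apply: filterS => k de.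
rewrite ger0_norm ?fine_ge0 // -lte_fin fineK //; exact: fin de.
Qed.

(** * The generalized absolute value equation *)

Definition gave_residual (R : realType) (m n : nat) (A B : 'M[R]_(m, n))
    (b : 'cV[R]_m) (x : 'cV[R]_n) : 'cV[R]_m := A *m x - B *m absv x - b.

Definition split_parts (R : realType) (n : nat) (x : 'cV[R]_n) :
  'cV[R]_(n + n) := col_mx (pos_part x) (neg_part x).

Definition merge_parts (R : realType) (n : nat) (y : 'cV[R]_(n + n)) :
  'cV[R]_n := usubmx y - dsubmx y.

Lemma compl_set_splitK (R : realType) (n : nat) (y : 'cV[R]_(n + n)) :
  compl_set y -> split_parts (merge_parts y) = y.
Proof.
move=> yC; rewrite -[RHS]vsubmxK; congr col_mx; apply/colP => i;
  have := yC i; rewrite !mxE => -[u0 v0 /eqP];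
  rewrite mulf_eq0 => /orP[]/eqP uv; rewrite uv.
- by rewrite sub0r max_r // oppr_le0.
- by rewrite subr0 max_l.
- by rewrite sub0r opprK max_l.
- by rewrite subr0 max_r // oppr_le0.
Qed.

Lemma residual_split_parts (R : realType) (m n : nat) (A B : 'M[R]_(m, n))
    (b : 'cV[R]_m) (x : 'cV[R]_n) :
  residual (A - B) (- A - B) b (split_parts x) = gave_residual A B b x.
Proof.
have xE : x = pos_part x - neg_part x.
  apply/colP => i; rewrite !mxE.
  by case: (leP (x i 0) 0); case: (leP (- x i 0) 0); lra.
have aE : absv x = pos_part x + neg_part x.
  apply/colP => i; rewrite !mxE; case: (leP (x i 0) 0) => x0.
    by rewrite ler0_norm // max_l ?oppr_ge0 // add0r.
  by rewrite gtr0_norm // max_r ?oppr_le0 ?(ltW x0) // addr0.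
rewrite /residual /gave_residual /Hmx mul_row_col aE {3}xE; congr (_ - b).
rewrite !mulmxDr !mulmxDl !mulNmx mulmxN.
by apply/colP => i; rewrite !mxE; ring.
Qed.

Lemma absv_lipschitz (R : realType) (n : nat) (x y : 'cV[R]_n) :
  enorm (absv x - absv y) <= enorm (x - y).
Proof.
by apply: enorm_le_coord => i; rewrite !mxE ler_dist_dist.
Qed.

Lemma split_parts_lipschitz (R : realType) (n : nat) (x y : 'cV[R]_n) :
  `|split_parts x - split_parts y| <= enorm (x - y).
Proof.
rewrite [leLHS]/Num.norm /= mx_normrE.
apply: bigmax_le => [|[i j] _ /=]; first exact: enorm_ge0.
have max_lip (a b : R) : `|Num.max a 0 - Num.max b 0| <= `|a - b|.
  have := ler_norm (a - b); have := ler_norm (b - a); rewrite (distrC b).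
  by rewrite ler_norml; case: (leP a 0); case: (leP b 0);
    move=> *; apply/andP; split; lra.
rewrite ord1 !mxE; case: fintype.split => k; rewrite !mxE.
  apply: le_trans (max_lip _ _) _.
  by have := coord_le_enorm (x - y) k; rewrite !mxE.
apply: le_trans (max_lip _ _) _; rewrite -opprD normrN.
by have := coord_le_enorm (x - y) k; rewrite !mxE.
Qed.

Lemma gave_residual_sub (R : realType) (m n : nat) (A B : 'M[R]_(m, n))
    (b : 'cV[R]_m) (x y : 'cV[R]_n) :
  gave_residual A B b x - gave_residual A B b y =
  A *m (x - y) - B *m (absv x - absv y).
Proof.
by rewrite /gave_residual !mulmxBr; apply/colP => i; rewrite !mxE; ring.
Qed.

Lemma gave_residual_lipschitz (R : realType) (m n : nat) (A B : 'M[R]_(m, n))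
    (b : 'cV[R]_m) (x y : 'cV[R]_n) :
  enorm (gave_residual A B b x) - enorm (gave_residual A B b y) <=
  (spectral_norm A + spectral_norm B) * enorm (x - y).
Proof.
apply: le_trans (enorm_triangle_sub _ _) _; rewrite gave_residual_sub mulrDl.
apply: le_trans (enorm_triangle _ _) _; rewrite enormN.
apply: lerD; first exact: enorm_mulmx.
apply: le_trans (enorm_mulmx _ _) _.
by rewrite ler_wpM2l ?spectral_norm_ge0 // absv_lipschitz.
Qed.

(** [| |x| - |y| | <= |x - y|], so the nonlinear term [B |x|] has Lipschitz
    constant [|B|], less than the expansion factor of [A] when the gap is
    positive. *)
Lemma gave_residual_expansive (R : realType) (n : nat) (A B : 'M[R]_n)
    (b x y : 'cV[R]_n) :
  0 < sigma_min A ->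
  (sigma_min A - spectral_norm B) * enorm (x - y) <=
  enorm (gave_residual A B b x - gave_residual A B b y).
Proof.
move=> s0; rewrite gave_residual_sub.
apply: le_trans (enorm_triangle_sub _ _).
rewrite mulrBl; apply: lerB; first exact: sigma_min_le_enorm.
apply: le_trans (enorm_mulmx _ _) _.
by rewrite ler_wpM2l ?spectral_norm_ge0 // absv_lipschitz.
Qed.

(** The fixed-point step [x' = A^-1 (B |x| + b)] satisfies [A (x - x') = r(x)], so
    its length is at most [|r(x)| / sigma_min A], and its own residual
    [B (|x| - |x'|)] is at most [|B|] times that length. *)
Lemma gave_residual_improve (R : realType) (n : nat) (A B : 'M[R]_n)
    (b x : 'cV[R]_n) :
  0 < sigma_min A ->
  exists x', sigma_min A * enorm (gave_residual A B b x') <=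
             spectral_norm B * enorm (gave_residual A B b x).
Proof.
move=> s0.
have Au := sigma_min_gt0_unitmx s0.
exists (invmx A *m (B *m absv x + b)); set x' := invmx A *m _.
have Ax' : A *m x' = B *m absv x + b by rewrite mulmxA mulmxV // mul1mx.
have rx' : gave_residual A B b x' = B *m (absv x - absv x').
  rewrite /gave_residual Ax' mulmxBr.
  by apply/colP => i; rewrite !mxE; ring.
have rx : gave_residual A B b x = A *m (x - x').
  by rewrite mulmxBr Ax' /gave_residual opprD addrA.
rewrite rx' rx.
apply: (@le_trans _ _ (sigma_min A * (spectral_norm B * enorm (x - x')))).
  rewrite ler_wpM2l ?(ltW s0) //; apply: le_trans (enorm_mulmx _ _) _.
  by rewrite ler_wpM2l ?spectral_norm_ge0 // absv_lipschitz.
by rewrite mulrCA ler_wpM2l ?spectral_norm_ge0 // sigma_min_le_enorm.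
Qed.

(** Expansivity makes the residual coercive, so that its norm attains its
    minimum; a nonzero minimum would be improved by a fixed-point step. *)
Lemma gave_solution_exists (R : realType) (n : nat) (A B : 'M[R]_n)
    (b : 'cV[R]_n) :
  0 < sigma_min A - spectral_norm B -> exists x, gave_solution A B b x.
Proof.
set delta := _ - _ => d0.
have s0 : 0 < sigma_min A.
  by have := spectral_norm_ge0 B; rewrite /delta in d0; lra.
pose e x := enorm (gave_residual A B b x).
have e0 : e 0 = enorm b.
  have a0 : absv (0 : 'cV[R]_n) = 0.
    by apply/colP => i; rewrite !mxE normr0.
  by rewrite /e /gave_residual a0 !mulmx0 subrr sub0r enormN.
(* Outside this ball expansivity bounds the residual below by its value at [0]. *)
pose ball := [set x : 'cV[R]_n | enorm x <= 2 * enorm b / delta].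
have ballc : compact ball.
  apply: (@enorm_bounded_closed_compact _ _ (2 * enorm b / delta)) => //.
  by apply: closed_comp (@closed_le _ _) => x _; apply: enorm_continuous.
have ball0 : ball 0.
  by rewrite /ball /= enorm0 divr_ge0 ?(ltW d0) // mulr_ge0 ?enorm_ge0.
have ec : {within ball, continuous e}.
  apply: continuous_subspaceT.
  apply: (@enorm_lipschitz_continuous _ _ _ e) => x y.
  exact: gave_residual_lipschitz.
have [|x xb xmin] := @compact_EVT_min _ R e ball _ ballc ec; first by exists 0.
have outside x' : ~ ball x' -> e 0 <= e x'.
  move/negP; rewrite -ltNge ltr_pdivrMr // => x'b; rewrite e0.
  have := gave_residual_expansive B b x' 0 s0; rewrite subr0 -/delta => H.
  have := le_trans H (enorm_triangle _ _).
  by rewrite enormN -/(e x') -/(e 0) e0; lra.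
have emin x' : e x <= e x'.
  have [x'b|/outside] := pselect (ball x'); first by apply: xmin; rewrite inE.
  by apply: le_trans; apply: xmin; rewrite inE.
exists x; apply/eqP; rewrite -subr_eq0; apply/eqP.
apply: enorm_eq0; rewrite -/(gave_residual A B b x) -/(e x).
have [x' Hx'] := gave_residual_improve B b x s0.
have Hx : sigma_min A * e x <= spectral_norm B * e x.
  by apply: le_trans Hx'; rewrite ler_wpM2l ?(ltW s0) // emin.
apply/eqP; rewrite eq_le enorm_ge0 andbT -(pmulr_rle0 _ d0) /delta mulrBl.
by rewrite subr_le0.
Qed.

(** * Stationary points and convergence *)

Theorem corollary2 (R : realType) (m n : nat) (A B : 'M[R]_(m, n))
    (b : 'cV[R]_m) :
  let P := A - B in
  let Q := - A - B in
  let c := b in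
  ((m <= n)%N ->
   0 < inf [set sigma_min (A - B *m D) | D in @unit_diag R n] ->
   (forall alpha : R, 0 < alpha ->
      forall y, proj_stationary P Q c alpha y -> sol_set P Q c y) /\
   (forall (alpha : nat -> R) (y : nat -> 'cV[R]_(n + n)),
      generated_by_spg P Q c alpha y ->
      admissible_steps (Lconst P Q) alpha ->
      bounded_seq y ->
      [/\ Phi P Q c (y k) @[k --> \oo] --> (0 : R),
          edistance (y k) (sol_set P Q c) @[k --> \oo] --> 0%E
        & cluster (y k @[k --> \oo]) `<=` sol_set P Q c]))
  /\
  (m = n ->
   0 < sigma_min A - spectral_norm B ->
   (exists! x : 'cV[R]_n, gave_solution A B b x) /\
   (forall xd : 'cV[R]_n, gave_solution A B b xd ->
      let yd := col_mx (pos_part xd) (neg_part xd) in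
      (forall alpha : R, 0 < alpha ->
         forall y, proj_stationary P Q c alpha y -> y = yd) /\
      (forall (alpha : nat -> R) (y : nat -> 'cV[R]_(n + n)),
         generated_by_spg P Q c alpha y ->
         admissible_steps (Lconst P Q) alpha ->
         y k @[k --> \oo] --> yd /\
         Phi P Q c (y k) @[k --> \oo] --> (0 : R)))).
Proof.
move=> P Q c; split=> [mn inf0|mn gap0].
  have co := uniformly_coercive_inf A B mn.
  split=> [alpha al0 y yst|alpha y gen adm bnd].
    by split; [case: yst|exact: stationary_residual0 co inf0 al0 yst].
  have Py := spg_Phi_cvg0 co inf0 gen adm.
  have yS : cluster (y k @[k --> \oo]) `<=` sol_set P Q c.
    apply: cluster_sol_set Py.
    by case: gen => [q [tau [ybar [nu [cand /spg_feasible]]]]].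
  by split=> //; apply/edistance_cvg0/bounded_near_cluster.
subst m.
have co := uniformly_coercive_gap A B (leqnn n).
have s0 : 0 < sigma_min A by have := spectral_norm_ge0 B; lra.
have solE x : gave_solution A B b x <-> gave_residual A B b x = 0.
  by split=> /eqP xs; apply/eqP; [rewrite subr_eq0|rewrite -subr_eq0].
have uniq x y : gave_solution A B b x -> gave_solution A B b y -> x = y.
  move=> /solE rx /solE ry; apply/eqP; rewrite -subr_eq0; apply/eqP.
  apply: enorm_eq0; apply/eqP; rewrite eq_le enorm_ge0 andbT.
  rewrite -(pmulr_rle0 _ gap0).
  by have := gave_residual_expansive B b x y s0; rewrite rx ry subrr enorm0.
split.
  have [x xs] := gave_solution_exists b gap0.
  by exists x; split=> // y ys; apply: uniq.
move=> xd xds yd; split=> [alpha al0 y yst|alpha y gen adm].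
  have r0 := stationary_residual0 co gap0 al0 yst.
  have yC := yst.1; rewrite -(compl_set_splitK yC); congr split_parts.
  apply: uniq => //; apply/solE.
  by rewrite -residual_split_parts compl_set_splitK.
have Py := spg_Phi_cvg0 co gap0 gen adm; split=> //.
have yC : forall k, compl_set (y k).
  by case: gen => [q [tau [ybar [nu [cand /spg_feasible]]]]].
apply/cvgrPdist_le => e e0.
have := Phi_cvg0_residual_near Py (mulr_gt0 gap0 e0); apply: filterS => k rk.
rewrite distrC -(compl_set_splitK (yC k)).
apply: le_trans (split_parts_lipschitz _ _) _.
rewrite -(ler_pM2l gap0).
apply: le_trans (gave_residual_expansive B b _ _ s0) _.
move/solE: xds => ->; rewrite subr0 -residual_split_parts.
by rewrite compl_set_splitK.
Qed.
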